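(* For $n\ge1$ let $U_n$ be the number of unimodal permutations in $S^3_n$ (defined in the context), and set $U_0=0$. Then \[\sum_{n\ge0}\frac{U_n}{n!}x^n=\frac{1}{\sqrt{2}}\left(\operatorname{arcsinh}\left(\frac{1}{\sinh\left(\operatorname{arcsinh}(1)-\sqrt{2}x\right)}\right)-\operatorname{arcsinh}(1)\right).\]
   Context: For $n\ge1$, $S_n$ is the set of permutations of $\{0,\dots,n-1\}$ in one-line notation. $S^3_n$ is the set of pairs $\Pi=(\pi^2,\pi^3)$ of elements of $S_n$; its elements are the columns $\Pi_j=(\pi^2_j,\pi^3_j)^T$ and the level of $\Pi_j$ is $\mathrm{lev}(\Pi_j)=\max\{\pi^2_j,\pi^3_j\}$. $\Pi$ is unimodal if for some $m$, $\mathrm{lev}(\Pi_1)<\dots<\mathrm{lev}(\Pi_m)>\mathrm{lev}(\Pi_{m+1})>\dots>\mathrm{lev}(\Pi_n)$ (strict ascents followed by strict descents, either part possibly empty). *)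

(* Defs.v *)
From mathcomp Require Import all_boot perm.
From Stdlib Require Import Reals.
From Coquelicot Require Import Coquelicot.

Set Implicit Arguments.
Unset Strict Implicit.
Unset Printing Implicit Defensive.

Local Open Scope nat_scope.

(* Pi.1 and Pi.2 stand for pi^2 and pi^3.  Columns are indexed by
   {0, ..., n-1} instead of {1, ..., n}. *)
Definition lev (n : nat) (Pi : 'S_n * 'S_n) (j : 'I_n) : nat :=
  maxn (Pi.1 j) (Pi.2 j).

(* The strict chain is required between consecutive columns: ascents up to
   the peak column m, descents after it. *)
Definition unimodal (n : nat) (Pi : 'S_n * 'S_n) : bool :=
  [exists m : 'I_n, forall i : 'I_n, forall j : 'I_n,
     (j == i.+1 :> nat) ==>
       (if j <= m then lev Pi i < lev Pi j
        else lev Pi j < lev Pi i)].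

Definition U (n : nat) : nat :=
  if n is 0 then 0 else #|[set Pi : 'S_n * 'S_n | unimodal Pi]|.

(* Main.v *)
Require Import Defs.
From mathcomp Require Import all_boot perm.
From Stdlib Require Import Reals.
From Coquelicot Require Import Coquelicot.
From mathcomp Require Import zify.
From Stdlib Require Import Lra.

(** Let [a(N,e)] be the number of unimodal pairs in [S_N^2] whose levels are all at
    least [e]. In such a pair a column of level [e] can only be the first or the last
    one. Deleting these columns and standardizing the rows gives
      [a(N,e) = a(N,e+1) + 2(2e+1) a(N-1,e) + 2e^2 a(N-2,e-1)].

    On the analytic side put [s = arcsinh 1 - sqrt 2 u], [z = 1 / sinh s], which is the
    derivative of the closed form, and [w = sqrt 2 coth s - 2]. Then [z' = z (w + 2)]
    and [w' = w^2 + 4w + 2], so the [n]-th derivative of [z] is [z] times a polynomial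
    in [w], whose coefficients satisfy the same recurrence after dividing [a(n+1+e,e)]
    by [2^e e!]. Since [z(0) = 1] and [w(0) = 0], that derivative at [0] is
    [a(n+1,0) = U_{n+1}]; bounding the coefficients by [7^n n!] in total makes the
    Taylor series converge to the function. *)

(** * Combinatorics: a recurrence for unimodal pairs with levels bounded below *)

Section Counting.

Local Set Implicit Arguments.
Local Unset Strict Implicit.
Local Unset Printing Implicit Defensive.
Local Open Scope nat_scope.

(** Sequences are functions on [nat] read only below [n]: deleting the last term lowers [n], and
    deleting the first one composes with [S]. *)
Definition peak_at (n : nat) (f : nat -> nat) (m : nat) : Prop :=
  m < n /\ forall i, i.+1 < n -> if i.+1 <= m then f i < f i.+1 else f i.+1 < f i.

Definition unim_ge (n e : nat) (f : nat -> nat) : Prop :=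
  (exists m, peak_at n f m) /\ forall i, i < n -> e <= f i.

Lemma peak_ascent n f m i j : peak_at n f m -> i <= j -> j <= m -> f i <= f j.
Proof.
move=> [ltmn step]; elim: j => [|j IH]; first by rewrite leqn0 => /eqP->.
rewrite leq_eqVlt => /predU1P[-> //|lti] ltjm.
have := step j (leq_ltn_trans ltjm ltmn); rewrite ltjm => /ltnW.
by apply: leq_trans; apply: IH => //; apply: ltnW.
Qed.

Lemma peak_descent n f m i j : peak_at n f m -> m <= i -> i <= j -> j < n -> f j <= f i.
Proof.
move=> [ltmn step] lemi; elim: j => [|j IH]; first by rewrite leqn0 => /eqP->.
rewrite leq_eqVlt => /predU1P[-> //|lti] ltjn.
have := step j ltjn; rewrite leqNgt ltnS (leq_trans lemi lti) /= => /ltnW /leq_trans.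
by apply; apply: IH => //; apply: ltnW.
Qed.

(** A unimodal sequence attains its minimum at an end, so lower bounds need checking only there. *)
Lemma peak_ends n f m i : peak_at n.+1 f m -> i <= n -> minn (f 0) (f n) <= f i.
Proof.
move=> pk lein; rewrite geq_min; have [leim | /ltnW lemi] := leqP i m.
  by rewrite (peak_ascent pk (leq0n i) leim).
by rewrite (peak_descent pk lemi lein (ltnSn n)) orbT.
Qed.

Lemma unim_ge_ends n e f :
  e < f 0 -> e < f n -> unim_ge n.+1 e f <-> unim_ge n.+1 e.+1 f.
Proof.
move=> lt0 ltn; split=> [] [[m pk] gef]; split; try by exists m.
  by move=> i ltin; apply: leq_trans (peak_ends pk ltin); rewrite leq_min lt0.
by move=> i ltin; apply/ltnW/gef.
Qed.

(** As [f 0 = e < f n], the peak is not the first term, so [f 1 > e]; both ends of the remaining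
    sequence exceed [e], hence by [peak_ends] all its terms do. Conversely, a smaller term in front
    only prolongs the ascent. *)
Lemma unim_ge_first n e f : 0 < n -> f 0 = e ->
  (e < f n /\ unim_ge n.+1 e f) <-> unim_ge n e.+1 (f \o S).
Proof.
case: n => // n _ f0; split=> [[fn [[m pk] gef]] | [[m pk] gef]].
  have m0 : 0 < m.
    rewrite lt0n; apply/eqP=> m0; rewrite m0 in pk.
    by have := peak_descent pk (leqnn 0) (leq0n n.+1) (ltnSn _); lia.
  have pkS : peak_at n.+1 (f \o S) m.-1.
    case: pk => ltm step; split; first by lia.
    by move=> i ltin; have := step i.+1 ltin; case: (m) m0.
  split; first by exists m.-1.
  move=> i ltin; apply: leq_trans (peak_ends pkS ltin); rewrite leq_min fn andbT.
  by have := pk.2 0 isT; rewrite m0 f0.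
split; first exact: gef n (ltnSn n).
split; last by case=> [|i] ltin; [rewrite f0 | apply/ltnW/gef].
exists m.+1; case: pk => ltm step; split=> // -[|i] ltin; last exact: step.
by rewrite /= f0; apply: gef.
Qed.

Lemma unim_ge_last n e f : 0 < n -> f n = e ->
  (e < f 0 /\ unim_ge n.+1 e f) <-> unim_ge n e.+1 f.
Proof.
case: n => // n _ fn; split=> [[f0 [[m pk] gef]] | [[m pk] gef]].
  have ltm : m < n.+1.
    rewrite ltnNge; apply/negP=> lem.
    by have := peak_ascent pk (leq0n n.+1) lem; lia.
  have pkS : peak_at n.+1 f m.
    by case: pk => _ step; split=> // i ltin; apply: step; apply: ltnW.
  split; first by exists m.
  move=> i ltin; apply: leq_trans (peak_ends pkS ltin); rewrite leq_min f0 /=.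
  by have := pk.2 n (ltnSn _); rewrite leqNgt ltm /= fn.
split; first exact: gef 0 isT.
split; last first.
  by move=> i; rewrite ltnS leq_eqVlt => /predU1P[->|/gef/ltnW //]; rewrite fn.
exists m; case: pk => ltm step; split=> [|i]; first exact: ltnW.
rewrite ltnS leq_eqVlt => /predU1P[[->]|]; last exact: step.
by rewrite leqNgt ltm /= fn; apply: gef.
Qed.

(** The peak is at neither end, since the neighbour of such a peak would lie below the bound [e].
    For [n = 0] both sides are false: two equal terms form no strict chain, and the empty sequence
    has no peak. *)
Lemma unim_ge_both n e f : f 0 = e -> f n.+1 = e ->
  unim_ge n.+2 e f <-> unim_ge n e.+1 (f \o S).
Proof.
move=> f0 fn; split=> [[[m pk] gef] | [[m pk] gef]].
  have m0 : 0 < m.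
    rewrite lt0n; apply/eqP=> m0; have := pk.2 0 isT; rewrite m0 /= f0.
    by have := gef 1 isT; lia.
  have ltm : m < n.+1.
    rewrite ltnNge; apply/negP=> lem; have := pk.2 n (ltnSn _); rewrite lem fn.
    by have := gef n (ltnW (ltnSn _)); lia.
  have f1 : e < f 1 by have := pk.2 0 isT; rewrite m0 f0.
  have fn1 : e < f n by have := pk.2 n (ltnSn _); rewrite leqNgt ltm /= fn.
  case: n {gef} fn pk ltm fn1 => [|n] fn pk ltm fn1; first by lia.
  have pkS : peak_at n.+1 (f \o S) m.-1.
    case: pk => _ step; split; first by lia.
    by move=> i ltin; have := step i.+1 (ltnW ltin); case: (m) m0.
  split; first by exists m.-1.
  by move=> i ltin; apply: leq_trans (peak_ends pkS ltin); rewrite leq_min f1.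
have n0 : 0 < n by case: pk => /(leq_ltn_trans _) ->.
split; last first.
  case=> [|i]; rewrite ?f0 // ltnS ltnS leq_eqVlt => /predU1P[->|/gef/ltnW //].
  by rewrite fn.
exists m.+1; case: pk => ltm step; split=> [|i]; first exact: ltnW.
case: i => [|i] ltin; first by rewrite /= f0; apply: gef.
move: ltin; rewrite ltnS ltnS leq_eqVlt => /predU1P[[ein]|]; last exact: step.
rewrite ein fn ifF; last by apply/negbTE; lia.
by rewrite -ein; apply: gef; rewrite ein.
Qed.

(** Terms of [g] that are at least [d] are raised by exactly one, which preserves comparisons;
    smaller terms may change irregularly, but the bounds on both sides exclude them. *)
Lemma unim_ge_shift n d f g :
  (forall i, i < n -> (d < f i) = (d <= g i)) ->
  (forall i, i < n -> d <= g i -> f i = (g i).+1) ->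
  unim_ge n d.+1 f <-> unim_ge n d g.
Proof.
move=> iff eqf; split=> [] [[m [ltm step]] ge].
  have geg i (ltin : i < n) : d <= g i by rewrite -iff ?ge.
  split=> //; exists m; split=> // i ltin; have ltin' := ltnW ltin.
  by have := step i ltin; rewrite !eqf ?geg //.
split; last by move=> i ltin; rewrite iff ?ge.
exists m; split=> // i ltin; have ltin' := ltnW ltin.
by have := step i ltin; rewrite !eqf ?ge //.
Qed.

(** * Deleting extreme columns *)

Definition level_at n (Pi : 'S_n * 'S_n) (k : nat) : nat :=
  oapp (lev Pi) 0 (insub k).

Lemma level_at_ord n (Pi : 'S_n * 'S_n) (i : 'I_n) : level_at Pi i = lev Pi i.
Proof. by rewrite /level_at valK. Qed.

Definition unimodal_ge n (e : nat) (Pi : 'S_n * 'S_n) : bool :=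
  unimodal Pi && [forall i, e <= lev Pi i].

Lemma unimodal_geP n e (Pi : 'S_n * 'S_n) :
  reflect (unim_ge n e (level_at Pi)) (unimodal_ge e Pi).
Proof.
apply: (iffP andP) => [[/existsP[m /forallP pk] /forallP ge]|[[m [ltm pk]] ge]].
  split=> [|i ltin]; last by rewrite (level_at_ord Pi (Ordinal ltin)).
  exists m; split=> // i ltin.
  have := pk (Ordinal (ltnW ltin)) => /forallP/(_ (Ordinal ltin)).
  by rewrite eqxx /= -!level_at_ord.
split; last by apply/forallP=> i; rewrite -level_at_ord ge.
apply/existsP; exists (Ordinal ltm); apply/forallP=> i; apply/forallP=> j.
apply/implyP=> /eqP eqj; have := pk i; rewrite -eqj -!level_at_ord => /(_ (ltn_ord j)).
by rewrite eqj.
Qed.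

(** Inverse of deleting column [i] and standardizing: [lift_perm] places the new entry at [i] and
    raises by one the old entries that are not below it. *)
Definition add_col n (i : 'I_n.+1) (c : 'I_n.+1 * 'I_n.+1) (Pi : 'S_n * 'S_n) :
    'S_n.+1 * 'S_n.+1 :=
  (lift_perm i c.1 Pi.1, lift_perm i c.2 Pi.2).

(* The level that the column [(x1, x2)] gets when a column [(c1, c2)] is inserted. *)
Definition bump_max (c1 c2 x1 x2 : nat) := maxn (bump c1 x1) (bump c2 x2).

Lemma lev_add_col n (i : 'I_n.+1) c Pi : lev (add_col i c Pi) i = maxn c.1 c.2.
Proof. by rewrite /lev !lift_perm_id. Qed.

Lemma lev_add_col_lift n (i : 'I_n.+1) c Pi k :
  lev (add_col i c Pi) (lift i k) = bump_max c.1 c.2 (Pi.1 k) (Pi.2 k).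
Proof. by rewrite /lev !lift_perm_lift. Qed.

(** Every entry that is at least [e] gets raised, and no smaller one gets past [e]. With [bump_maxE]
    this provides the hypotheses of [unim_ge_shift]. *)
Lemma bump_max_gt e c1 c2 x1 x2 : c1 <= e -> c2 <= e ->
  (e < bump_max c1 c2 x1 x2) = (e <= maxn x1 x2).
Proof. by rewrite /bump_max /bump; lia. Qed.

Lemma bump_maxE e c1 c2 x1 x2 : c1 <= e -> c2 <= e -> e <= maxn x1 x2 ->
  bump_max c1 c2 x1 x2 = (maxn x1 x2).+1.
Proof. by rewrite /bump_max /bump; lia. Qed.

(** Injectivity holds because the new entries and the old rows can be read back; both sides have
    [((n+1)!)^2] elements. *)
Lemma add_col_bij n (i : 'I_n.+1) :
  bijective (fun p : ('I_n.+1 * 'I_n.+1) * ('S_n * 'S_n) => add_col i p.1 p.2).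
Proof.
have inj a b (s t : 'S_n) : lift_perm i a s = lift_perm i b t -> a = b /\ s = t.
  move=> eqab; have eab : a = b by rewrite -(lift_perm_id i a s) eqab lift_perm_id.
  rewrite -{b}eab in eqab *; split=> //; apply/permP=> k; apply: (@lift_inj _ a).
  by rewrite -!(lift_perm_lift i) eqab.
apply: inj_card_bij => [[[a b] [s t]] [[a' b'] [s' t']] /= [eq1 eq2]|]; last first.
  by rewrite !card_prod !card_ord !card_Sn factS; lia.
by have [-> ->] := inj _ _ _ _ eq1; have [-> ->] := inj _ _ _ _ eq2.
Qed.

Lemma card_add_col n (i : 'I_n.+1) (P : pred ('S_n.+1 * 'S_n.+1)) :
  #|[set Pi | P Pi]| = \sum_c #|[set Pi | P (add_col i c Pi)]|.
Proof.
rewrite -sum1dep_card (reindex _ (onW_bij _ (add_col_bij i))) /=.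
rewrite -(pair_big_dep xpredT (fun c Pi => P (add_col i c Pi)) (fun _ _ => 1)) /=.
by apply: eq_bigr => c _; rewrite -sum1dep_card.
Qed.

(** * Pairs classified by the levels of their two end columns *)

Definition count_ge (n e : nat) : nat := #|[set Pi : 'S_n * 'S_n | unimodal_ge e Pi]|.

Lemma card_lev_split n e (P : pred ('S_n.+1 * 'S_n.+1)) (i : 'I_n.+1) :
  #|[set Pi | P Pi]| =
  #|[set Pi | P Pi && (lev Pi i == e)]| + #|[set Pi | P Pi && (lev Pi i != e)]|.
Proof.
rewrite -(cardsID [set Pi | lev Pi i == e]); congr (_ + _); apply: eq_card => Pi.
  by rewrite !inE.
by rewrite !inE andbC.
Qed.

Lemma card_ord_lt n e : e <= n -> #|[set x : 'I_n | x < e]| = e.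
Proof. by move=> len; rewrite -sum1dep_card (big_ord_narrow len) sum1_card card_ord. Qed.

Lemma card_max_neq n (e : 'I_n) :
  #|[set c : 'I_n * 'I_n | (maxn c.1 c.2 == e) && (c.1 != c.2)]| = e.*2.
Proof.
have lte := ltnW (ltn_ord e); set L := [set x : 'I_n | x < e].
have cL : #|L| = e by apply: card_ord_lt.
transitivity #|setX [set e] L :|: setX L [set e]|.
  apply: eq_card => -[a b]; rewrite !inE /= -!val_eqE /=; lia.
rewrite cardsU !cardsX cards1 mul1n muln1 cL addnn [X in _ - X](_ : _ = 0) ?subn0 //.
apply: eq_card0 => -[a b]; rewrite !inE /= -!val_eqE /=; lia.
Qed.

Lemma card_max n (e : 'I_n) :
  #|[set c : 'I_n * 'I_n | maxn c.1 c.2 == e]| = e.*2.+1.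
Proof.
rewrite -card_max_neq (cardsD1 (e, e)) inE /= maxnn eqxx; congr _.+1.
by apply: eq_card => -[a b]; rewrite !inE /= xpair_eqE -!val_eqE /=; lia.
Qed.

(** This counts the opposite end columns that share the level of [c]. A row cannot repeat its entry
    of [c], so there is none if [c.1 = c.2]. If [c.1 < c.2], the first row must supply the level,
    which forces [d.1 = c.2 - 1], while [d.2] is any value below [c.2]; the other case is
    symmetric. *)
Lemma card_bump_max n (c : 'I_n.+1 * 'I_n.+1) :
  #|[set d : 'I_n * 'I_n | bump_max c.1 c.2 d.1 d.2 == maxn c.1 c.2]| =
  (c.1 != c.2) * maxn c.1 c.2.
Proof.
case: c => a b /=; have [<-|] := eqVneq a b.
  rewrite mul0n; apply: eq_card0 => -[x y]; rewrite !inE /bump_max /bump /=; lia.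
rewrite -val_eqE /= mul1n neq_ltn => /orP[] ltab.
  have ltb : b.-1 < n by have := ltn_ord b; lia.
  have leb : b <= n by have := ltn_ord b; lia.
  rewrite (maxn_idPr (ltnW ltab)) -[RHS](card_ord_lt leb).
  set L := [set x : 'I_n | x < b].
  transitivity #|setX [set Ordinal ltb] L|; last by rewrite cardsX cards1 mul1n.
  apply: eq_card => -[x y]; rewrite !inE /= -!val_eqE /bump_max /bump /=; lia.
have lta : a.-1 < n by have := ltn_ord a; lia.
have lea : a <= n by have := ltn_ord a; lia.
rewrite (maxn_idPl (ltnW ltab)) -[RHS](card_ord_lt lea).
set L := [set x : 'I_n | x < a].
transitivity #|setX L [set Ordinal lta]|; last by rewrite cardsX cards1 muln1.
apply: eq_card => -[x y]; rewrite !inE /= -!val_eqE /bump_max /bump /=; lia.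
Qed.

Lemma level_at_add_first n c (Pi : 'S_n * 'S_n) k (ltk : k < n) :
  level_at (add_col ord0 c Pi) k.+1 =
  bump_max c.1 c.2 (Pi.1 (Ordinal ltk)) (Pi.2 (Ordinal ltk)).
Proof. by rewrite -(lev_add_col_lift ord0) -level_at_ord. Qed.

Lemma level_at_add_last n c (Pi : 'S_n * 'S_n) k (ltk : k < n) :
  level_at (add_col ord_max c Pi) k =
  bump_max c.1 c.2 (Pi.1 (Ordinal ltk)) (Pi.2 (Ordinal ltk)).
Proof. by rewrite -(lev_add_col_lift ord_max) -level_at_ord lift_max. Qed.

(** The length [m] is separate from [n] so that [unimodal_ge_add_both] can leave out the last
    column. *)
Lemma unim_ge_add_first n m e (c : 'I_n.+1 * 'I_n.+1) (Pi : 'S_n * 'S_n) :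
  m <= n -> c.1 <= e -> c.2 <= e ->
  unim_ge m e.+1 (level_at (add_col ord0 c Pi) \o S) <-> unim_ge m e (level_at Pi).
Proof.
move=> lemn c1 c2; apply: unim_ge_shift => i ltim /=;
  have ltin := leq_trans ltim lemn; rewrite level_at_add_first.
  by rewrite (level_at_ord _ (Ordinal ltin)) bump_max_gt.
by rewrite (level_at_ord _ (Ordinal ltin)); apply: bump_maxE.
Qed.

Lemma unim_ge_add_last n e (c : 'I_n.+1 * 'I_n.+1) (Pi : 'S_n * 'S_n) : c.1 <= e -> c.2 <= e ->
  unim_ge n e.+1 (level_at (add_col ord_max c Pi)) <-> unim_ge n e (level_at Pi).
Proof.
move=> c1 c2; apply: unim_ge_shift => i ltin /=; rewrite level_at_add_last.
  by rewrite (level_at_ord _ (Ordinal ltin)) bump_max_gt.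
by rewrite (level_at_ord _ (Ordinal ltin)); apply: bump_maxE.
Qed.

Lemma lev_neq n e (Pi : 'S_n * 'S_n) i : unimodal_ge e Pi ->
  (lev Pi i != e) = (e < level_at Pi i).
Proof.
move=> /andP[_ /forallP/(_ i)]; rewrite level_at_ord; lia.
Qed.

Lemma card_gt_ends n e :
  #|[set Pi : 'S_n.+1 * 'S_n.+1 |
      unimodal_ge e Pi && (lev Pi ord0 != e) && (lev Pi ord_max != e)]| = count_ge n.+1 e.+1.
Proof.
apply: eq_card => Pi; rewrite !inE; apply/idP/idP => [/andP[/andP[Pu]]|Pu].
  rewrite !lev_neq //= => lt0 ltn; apply/unimodal_geP.
  by apply/(unim_ge_ends lt0 ltn)/unimodal_geP.
have /andP[_ /forallP gt] := Pu.
have lt0 : e < level_at Pi 0 by rewrite (level_at_ord _ ord0).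
have ltn : e < level_at Pi n by rewrite (level_at_ord _ ord_max).
have Pu' : unimodal_ge e Pi.
  by apply/unimodal_geP/(unim_ge_ends lt0 ltn)/unimodal_geP.
by rewrite Pu' !lev_neq // lt0 ltn.
Qed.

Lemma unimodal_ge_add_first n e (c : 'I_n.+1 * 'I_n.+1) (Pi : 'S_n * 'S_n) : 0 < n ->
  let Q := add_col ord0 c Pi in
  unimodal_ge e Q && (lev Q ord0 == e) && (lev Q ord_max != e) =
  (maxn c.1 c.2 == e) && unimodal_ge e Pi.
Proof.
move=> n0 Q; rewrite lev_add_col.
have [eqc|_] := eqVneq (maxn c.1 c.2) e; last by rewrite andbF.
have eq0 : level_at Q 0 = e by rewrite (level_at_ord Q ord0) lev_add_col.
have [c1 c2] : c.1 <= e /\ c.2 <= e by lia.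
rewrite andbT; apply/andP/unimodal_geP => [[Qu ltn]|Pu].
  apply/(unim_ge_add_first _ (leqnn n) c1 c2)/unim_ge_first => //.
  by rewrite -(lev_neq ord_max Qu); split=> //; apply/unimodal_geP.
have [ltn Qu] : e < level_at Q n /\ unim_ge n.+1 e (level_at Q).
  by apply/unim_ge_first => //; apply/unim_ge_add_first.
by move/unimodal_geP: Qu => Qu; rewrite (lev_neq ord_max Qu).
Qed.

Lemma unimodal_ge_add_last n e (c : 'I_n.+1 * 'I_n.+1) (Pi : 'S_n * 'S_n) : 0 < n ->
  let Q := add_col ord_max c Pi in
  unimodal_ge e Q && (lev Q ord0 != e) && (lev Q ord_max == e) =
  (maxn c.1 c.2 == e) && unimodal_ge e Pi.
Proof.
move=> n0 Q; rewrite lev_add_col.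
have [eqc|_] := eqVneq (maxn c.1 c.2) e; last by rewrite andbF.
have eqn : level_at Q n = e by rewrite (level_at_ord Q ord_max) lev_add_col.
have [c1 c2] : c.1 <= e /\ c.2 <= e by lia.
rewrite andbT; apply/andP/unimodal_geP => [[Qu lt0]|Pu].
  apply/(unim_ge_add_last _ c1 c2)/unim_ge_last => //.
  by rewrite -(lev_neq ord0 Qu); split=> //; apply/unimodal_geP.
have [lt0 Qu] : e < level_at Q 0 /\ unim_ge n.+1 e (level_at Q).
  by apply/unim_ge_last => //; apply/unim_ge_add_last.
by move/unimodal_geP: Qu => Qu; rewrite (lev_neq ord0 Qu).
Qed.

Lemma unimodal_ge_add_both n e (c : 'I_n.+2 * 'I_n.+2) (d : 'I_n.+1 * 'I_n.+1)
    (Pi : 'S_n * 'S_n) :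
  let Q := add_col ord0 c (add_col ord_max d Pi) in
  unimodal_ge e Q && (lev Q ord0 == e) && (lev Q ord_max == e) =
  [&& maxn c.1 c.2 == e, bump_max c.1 c.2 d.1 d.2 == e & unimodal_ge e.-1 Pi].
Proof.
move=> Q.
have lQn : lev Q ord_max = bump_max c.1 c.2 d.1 d.2.
  have -> : ord_max = lift ord0 (ord_max : 'I_n.+1) by apply/val_inj.
  by rewrite lev_add_col_lift !lift_perm_id.
rewrite lQn lev_add_col -andbA andbC -andbA.
have [eqc|//] := eqVneq (maxn c.1 c.2) e.
have [eqd|//] := eqVneq (bump_max c.1 c.2 d.1 d.2) e.
have [c1 c2] : c.1 <= e /\ c.2 <= e by lia.
(* An entry of [d] that is at least [e] would be raised above [e]; so both entries are below [e],
   which is therefore positive. *)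
have [e0 [d1 d2]] : 0 < e /\ (d.1 <= e.-1 /\ d.2 <= e.-1).
  by move: eqd eqc; rewrite /bump_max /bump; lia.
have eq0 : level_at Q 0 = e by rewrite (level_at_ord Q ord0) lev_add_col.
have eqn : level_at Q n.+1 = e by rewrite (level_at_ord Q ord_max) lQn.
have both := unim_ge_both eq0 eqn.
have fst := unim_ge_add_first (add_col ord_max d Pi) (leqnSn n) c1 c2.
have := unim_ge_add_last Pi d1 d2; rewrite (ltn_predK e0) => lst.
rewrite /=; apply/unimodal_geP/unimodal_geP.
  by move/(proj1 both)/(proj1 fst)/(proj1 lst).
by move/(proj2 lst)/(proj2 fst)/(proj2 both).
Qed.

Lemma sum_card_if (I T : finType) (P : pred I) (S : pred T) :
  \sum_i #|[set x | P i && S x]| = #|[set i | P i]| * #|[set x | S x]|.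
Proof.
rewrite -sum1dep_card big_distrl /= [RHS]big_mkcond; apply: eq_bigr => i _.
by case: (P i); rewrite ?mul1n //; apply: eq_card0 => x; rewrite inE.
Qed.

Lemma card_first n e : 0 < n -> e <= n ->
  #|[set Pi : 'S_n.+1 * 'S_n.+1 |
      unimodal_ge e Pi && (lev Pi ord0 == e) && (lev Pi ord_max != e)]| =
  e.*2.+1 * count_ge n e.
Proof.
move=> n0; rewrite -ltnS => lte; rewrite (card_add_col ord0) -(card_max (Ordinal lte)).
rewrite -sum_card_if; apply: eq_bigr => c _; apply: eq_card => Pi.
by rewrite !inE unimodal_ge_add_first.
Qed.

Lemma card_last n e : 0 < n -> e <= n ->
  #|[set Pi : 'S_n.+1 * 'S_n.+1 |
      unimodal_ge e Pi && (lev Pi ord0 != e) && (lev Pi ord_max == e)]| =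
  e.*2.+1 * count_ge n e.
Proof.
move=> n0; rewrite -ltnS => lte; rewrite (card_add_col ord_max) -(card_max (Ordinal lte)).
rewrite -sum_card_if; apply: eq_bigr => c _; apply: eq_card => Pi.
by rewrite !inE unimodal_ge_add_last.
Qed.

(** There are [2e] first columns with distinct entries, each leaving [e] choices for the last
    column; a first column with equal entries leaves none. For [e = 0] the term with the truncated
    [e.-1] has factor 0. *)
Lemma card_both n e : e <= n.+1 ->
  #|[set Pi : 'S_n.+2 * 'S_n.+2 |
      unimodal_ge e Pi && (lev Pi ord0 == e) && (lev Pi ord_max == e)]| =
  e.*2 * e * count_ge n e.-1.
Proof.
rewrite -ltnS => lte.
rewrite (card_add_col ord0) -(card_max_neq (Ordinal lte)) /= -sum1dep_card !big_distrl /=.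
rewrite [RHS]big_mkcond; apply: eq_bigr => c _; rewrite (card_add_col ord_max) mul1n.
under eq_bigr => d _ do under eq_finset => Pi do rewrite unimodal_ge_add_both.
have [eqc|_] := eqVneq (maxn c.1 c.2) e; last first.
  by apply: big1 => d _; apply: eq_card0 => x; rewrite inE.
rewrite /= (sum_card_if (fun d : 'I_n.+1 * 'I_n.+1 => bump_max c.1 c.2 d.1 d.2 == e)).
rewrite -[in X in X * _]eqc card_bump_max eqc -/(count_ge n e.-1).
by case: eqP; rewrite ?mul0n ?mul1n.
Qed.

Lemma count_ge_rec n e : e <= n.+1 ->
  count_ge n.+2 e =
  count_ge n.+2 e.+1 + e.*2.+1.*2 * count_ge n.+1 e + e.*2 * e * count_ge n e.-1.
Proof.
move=> len; rewrite {1}/count_ge (card_lev_split e _ ord0).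
rewrite [X in X + _](card_lev_split e _ ord_max).
rewrite [X in _ + X](card_lev_split e _ ord_max) /=.
by rewrite card_both // card_first // card_last // card_gt_ends; lia.
Qed.

Lemma count_ge_big n e : n <= e -> count_ge n e = 0.
Proof.
move=> len; apply: eq_card0 => Pi; rewrite !inE; apply/unimodal_geP => -[[m [ltm _]] ge].
have := ge m ltm; rewrite (level_at_ord _ (Ordinal ltm)) leqNgt gtn_max.
by rewrite !(leq_trans (ltn_ord _) len).
Qed.

Lemma count_ge_one : count_ge 1 0 = 1.
Proof.
rewrite /count_ge (eq_card (B := [set: 'S_1 * 'S_1])) ?cardsT ?card_prod ?card_Sn // => Pi.
rewrite !inE; apply/unimodal_geP; split=> //.
by exists 0; split.
Qed.

Lemma U_count_ge n : U n = count_ge n 0.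
Proof.
case: n => [|n]; first by rewrite count_ge_big.
apply: eq_card => Pi; rewrite !inE /unimodal_ge andb_idr // => _.
by apply/forallP.
Qed.

End Counting.

Local Open Scope R_scope.

(** * Coefficients of the derivatives *)

Lemma INR_addn (m n : nat) : INR (m + n)%nat = INR m + INR n.
Proof. exact: plus_INR. Qed.

Lemma INR_muln (m n : nat) : INR (m * n)%nat = INR m * INR n.
Proof. exact: mult_INR. Qed.

Lemma INR_factorial_gt0 n : 0 < INR n`!.
Proof. by apply: lt_0_INR; apply/ltP; apply: fact_gt0. Qed.

(* The coefficient of [w ^ e] in the [n]-th derivative of [z], divided by [z]. *)
Definition coef (n e : nat) : R := INR (count_ge (n.+1 + e) e) / (2 ^ e * INR e`!).

Lemma coef_ge0 n e : 0 <= coef n e.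
Proof.
apply: Rdiv_le_0_compat; first exact: pos_INR.
by apply: Rmult_lt_0_compat; [apply: pow_lt; lra | exact: INR_factorial_gt0].
Qed.

Lemma coef_zero e : coef 0 e = if e is 0%nat then 1 else 0.
Proof.
case: e => [|e]; first by rewrite /coef count_ge_one /=; field.
by rewrite /coef addSn add0n count_ge_rec // !count_ge_big // !muln0 /= /Rdiv Rmult_0_l.
Qed.

(** In [count_ge_rec] for length [n + 2 + e], length minus bound is [n + 1] in every term on the
    right (in the last one for [e > 0]), so each is a multiple of some [coef n]. Dividing by
    [2^e e!] turns the factors [1] and [2e^2] into [2(e+1)] and [e]. *)
Lemma coef_succ n e :
  coef n.+1 e = 2 * INR e.+1 * coef n e.+1 + (2 + 4 * INR e) * coef n e
                + INR e * coef n e.-1.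
Proof.
have two k : 2 ^ k <> 0 by apply: pow_nonzero; lra.
have fk k := Rgt_not_eq _ _ (INR_factorial_gt0 k).
have leN : (e <= (n + e).+1)%nat by rewrite leqW ?leq_addl.
rewrite /coef !addSn (count_ge_rec leN) addnS -!addnn factS.
rewrite !(INR_addn, INR_muln, S_INR).
case: e leN => [|e] _.
  by rewrite ![INR 0]/= !addn0 /=; field.
rewrite ![e.+1.-1]/= addnS !factS !INR_muln !S_INR.
have ? : INR e + 1 <> 0 by rewrite -S_INR; apply: not_0_INR.
have ? : INR e + 1 + 1 <> 0 by rewrite -!S_INR; apply: not_0_INR.
by rewrite -!tech_pow_Rmult; field; repeat split.
Qed.

(** The polynomial in [w] has degree at most [n]: each use of [coef_succ] raises the degree by at
    most one. *)
Lemma coef_gt n e : (n < e)%nat -> coef n e = 0.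
Proof.
elim: n e => [|n IH] [|e] // lt; first by rewrite coef_zero.
rewrite coef_succ (IH e lt) (IH e.+1 (leqW lt)) (IH e.+2 (leqW (leqW lt))).
by ring.
Qed.

(* The derivative of [z * sum_e coef n e * w ^ e], reorganised by powers of [w];
   the boundary terms vanish when [N > n]. *)
Lemma sum_coef_succ n N w :
  sum_f_R0 (fun e => coef n.+1 e * w ^ e) N =
  sum_f_R0 (fun e => coef n e * (INR e.+1 * w ^ e.+1 + (2 + 4 * INR e) * w ^ e
                              + 2 * INR e * w ^ e.-1)) N
  - INR N.+1 * coef n N * w ^ N.+1 + 2 * INR N.+1 * coef n N.+1 * w ^ N.
Proof.
elim: N => [|N IH].
  by rewrite /= coef_succ /=; ring.
rewrite !tech5 IH coef_succ !S_INR /=; ring.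
Qed.

Lemma sum_coef_derive n w :
  sum_f_R0 (fun e => coef n e * (INR e.+1 * w ^ e.+1 + (2 + 4 * INR e) * w ^ e
                              + 2 * INR e * w ^ e.-1)) n
  = sum_f_R0 (fun e => coef n.+1 e * w ^ e) n.+1.
Proof.
rewrite sum_coef_succ tech5 (coef_gt n n.+1) ?(coef_gt n n.+2) //.
by ring.
Qed.

(** The sum of the coefficients is the value at [w = 1], where [sum_coef_derive] multiplies
    [coef n e] by [(e+1) + (2+4e) + 2e = 7e + 3], at most [7(n+1)]. *)
Lemma sum_coef_le n : sum_f_R0 (coef n) n <= 7 ^ n * INR n`!.
Proof.
elim: n => [|n IH]; first by rewrite [sum_f_R0 _ _]coef_zero /=; lra.
rewrite (sum_eq _ (fun e => coef n.+1 e * 1 ^ e)) => [|e _]; last first.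
  by rewrite pow1 Rmult_1_r.
rewrite -sum_coef_derive.
apply: Rle_trans (_ : 7 * INR n.+1 * sum_f_R0 (coef n) n <= _); last first.
  rewrite factS INR_muln -tech_pow_Rmult.
  have ? : 0 <= INR n.+1 by apply: pos_INR.
  by nra.
rewrite scal_sum; apply: sum_Rle => e len.
have ? : INR e <= INR n by apply: le_INR.
rewrite !pow1 /mult /= -!/(INR _.+1) !S_INR.
by have := coef_ge0 n e; have := pos_INR e; nra.
Qed.

(** * Convergence of Taylor series *)

(** The Taylor polynomial is differentiated in its base point: the sum telescopes and only the last
    term survives. *)
Lemma is_derive_taylor (G : nat -> R -> R) (x t : R) (n : nat) :
  (forall k, is_derive (G k) t (G k.+1 t)) ->
  is_derive (fun t => sum_f_R0 (fun k => G k t * (x - t) ^ k / INR k`!) n) t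
    (G n.+1 t * (x - t) ^ n / INR n`!).
Proof.
move=> dG; elim: n => [|n IH].
  apply: (is_derive_ext (G 0%nat)) => [u|]; first by rewrite /= Rmult_1_r Rdiv_1_r.
  by rewrite /= Rdiv_1_r Rmult_1_r.
apply: (is_derive_ext (fun u => sum_f_R0 (fun k => G k u * (x - u) ^ k / INR k`!) n +
   G n.+1 u * ((x - u) ^ n.+1 / INR n.+1`!))) => [u|].
  by rewrite tech5 /Rdiv -Rmult_assoc.
have dp : is_derive (fun u => (x - u) ^ n.+1 / INR n.+1`!) t
                    (- (x - t) ^ n / INR n`!).
  auto_derive => //=; rewrite factS INR_muln.
  have := INR_factorial_gt0 n; have := pos_INR n => ? ?.
  rewrite -[X in _ * (X * _)]/(INR n.+1) S_INR -!/(x - t); field; lra.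
have := is_derive_plus _ _ _ _ _ IH (is_derive_mult _ _ _ _ _ (dG n.+1) dp Rmult_comm).
congr is_derive; rewrite /plus /mult /=; field.
by split; apply: Rgt_not_eq; apply: INR_factorial_gt0.
Qed.

(** Cauchy's form of the remainder has [n!] in the denominator, which cancels the factorial in the
    bound and leaves at most [K r (M r)^n]. *)
Lemma is_pseries_taylor (G : nat -> R -> R) (r K M : R) :
  0 <= M -> M * r < 1 ->
  (forall n t, Rabs t < r -> is_derive (G n) t (G n.+1 t)) ->
  (forall n t, Rabs t < r -> Rabs (G n.+1 t) <= K * M ^ n * INR n`!) ->
  forall x, Rabs x < r -> is_pseries (fun n => G n 0 / INR n`!) x (G 0%nat x).
Proof.
move=> M0 Mr dG bG x xr; apply/is_pseries_R.
(* The base point [t] varies: [T n x] is [G 0 x], [T n 0] is the partial sum, and the mean value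
   theorem controls their difference. *)
pose T n t := sum_f_R0 (fun k => G k t * (x - t) ^ k / INR k`!) n.
have r0 : 0 < r by have := Rabs_pos x; lra.
have between t : Rmin 0 x <= t <= Rmax 0 x -> Rabs t <= Rabs x /\ Rabs (x - t) <= Rabs x.
  rewrite /Rmin /Rmax; case: Rle_dec => ? ?; rewrite /Rabs;
    repeat case: Rcase_abs => ?; lra.
have err n : Rabs (T n 0 - G 0%nat x) <= K * r * (M * r) ^ n.
  have Tx : T n x = G 0%nat x.
    rewrite /T; elim: (n) => [|m IH]; first by rewrite /=; field.
    by rewrite tech5 IH Rminus_diag /= /Rdiv; ring.
  have dT t : Rmin 0 x <= t <= Rmax 0 x ->
      is_derive (T n) t (G n.+1 t * (x - t) ^ n / INR n`!).
    by move=> /between[lt _]; apply: is_derive_taylor => k; apply: dG; lra.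
  have [||c [/between[cx xc] eqT]]
    := MVT_gen (T n) 0 x (fun t => G n.+1 t * (x - t) ^ n / INR n`!).
  - by move=> t ?; apply: dT; lra.
  - move=> t /dT dTt; apply/continuity_pt_filterlim.
    by apply: ex_derive_continuous; eexists; apply: dTt.
  rewrite -Tx -Rabs_Ropp Ropp_minus_distr eqT Rminus_0_r.
  have fn0 := INR_factorial_gt0 n.
  rewrite /Rdiv !Rabs_mult -RPow_abs (Rabs_pos_eq (/ _)); last first.
    by apply/Rlt_le/Rinv_0_lt_compat.
  rewrite Rpow_mult_distr.
  have -> : K * r * (M ^ n * r ^ n) = (K * M ^ n * INR n`!) * r ^ n * / INR n`! * r.
    by field; lra.
  have cr : Rabs c < r by lra.
  have xc0 := Rabs_pos (x - c).
  apply: Rmult_le_compat; try lra; try exact: Rabs_pos.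
    repeat apply: Rmult_le_pos; try exact: Rabs_pos; try exact: pow_le.
    by apply/Rlt_le/Rinv_0_lt_compat.
  apply: Rmult_le_compat_r; first by apply/Rlt_le/Rinv_0_lt_compat.
  apply: Rmult_le_compat; try exact: Rabs_pos; try exact: pow_le; first exact: bG.
  by apply: pow_incr; lra.
have lim0 : is_lim_seq (fun n => T n 0 - G 0%nat x) 0.
  apply/is_lim_seq_abs_0.
  apply: (is_lim_seq_le_le (fun _ => 0) _ (fun n => K * r * (M * r) ^ n)).
  - by move=> n; split; [apply: Rabs_pos | apply: err].
  - exact: is_lim_seq_const.
  - have -> : Finite 0 = Rbar_mult (K * r) 0 by rewrite /= Rmult_0_r.
    apply: is_lim_seq_scal_l; apply: is_lim_seq_geom.
    by rewrite Rabs_pos_eq //; apply: Rmult_le_pos => //; lra.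
have : is_lim_seq (fun n => T n 0 - G 0%nat x + G 0%nat x) (0 + G 0%nat x).
  by apply: is_lim_seq_plus' lim0 _; apply: is_lim_seq_const.
rewrite Rplus_0_l; apply: is_lim_seq_ext => n; rewrite /T Rplus_assoc Rplus_opp_l Rplus_0_r.
rewrite -sum_n_Reals; apply: sum_n_ext => k; rewrite Rminus_0_r /Rdiv.
by rewrite !Rmult_assoc (Rmult_comm (x ^ k)).
Qed.

(** * The generating function *)

Lemma is_derive_eq (f : R -> R) (x a b : R) : is_derive f x a -> a = b -> is_derive f x b.
Proof. by move=> df <-. Qed.

Definition s (u : R) : R := arcsinh 1 - sqrt 2 * u.
Definition z (u : R) : R := / sinh (s u).
(** The shift by 2 gives [w 0 = 0], so only [coef n 0] survives at 0. *)
Definition w (u : R) : R := sqrt 2 * cosh (s u) / sinh (s u) - 2.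

Lemma sqrt2_sq : sqrt 2 * sqrt 2 = 2.
Proof. by apply: sqrt_sqrt; lra. Qed.

Lemma is_derive_sinh x : is_derive sinh x (cosh x).
Proof. by apply/is_derive_Reals; exact: derivable_pt_lim_sinh. Qed.

Lemma is_derive_cosh x : is_derive cosh x (sinh x).
Proof. by apply/is_derive_Reals; exact: derivable_pt_lim_cosh. Qed.

Lemma is_derive_arcsinh x : is_derive arcsinh x (/ sqrt (x ^ 2 + 1)).
Proof. by apply/is_derive_Reals; exact: derivable_pt_lim_arcsinh. Qed.

Lemma cosh2 x : cosh x * cosh x = 1 + sinh x * sinh x.
Proof.
rewrite /cosh /sinh; have : exp x * exp (- x) = 1 by rewrite -exp_plus Rplus_opp_r exp_0.
by nra.
Qed.

Lemma cosh_gt0 x : 0 < cosh x.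
Proof. by rewrite /cosh; have := exp_pos x; have := exp_pos (- x); lra. Qed.

Lemma is_derive_s u : is_derive s u (- sqrt 2).
Proof. by rewrite /s; auto_derive => //; ring. Qed.

Lemma is_derive_sinh_s u : is_derive (fun u => sinh (s u)) u (- sqrt 2 * cosh (s u)).
Proof. exact: is_derive_comp (is_derive_sinh (s u)) (is_derive_s u). Qed.

Lemma is_derive_cosh_s u : is_derive (fun u => cosh (s u)) u (- sqrt 2 * sinh (s u)).
Proof. exact: is_derive_comp (is_derive_cosh (s u)) (is_derive_s u). Qed.

Lemma is_derive_z u : sinh (s u) <> 0 -> is_derive z u (z u * (w u + 2)).
Proof.
move=> nz; apply: is_derive_eq (is_derive_inv _ _ _ (is_derive_sinh_s u) nz) _.
by rewrite /z /w; field.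
Qed.

Lemma is_derive_w u : sinh (s u) <> 0 -> is_derive w u (w u ^ 2 + 4 * w u + 2).
Proof.
move=> nz; have sh := is_derive_sinh_s u; have ch := is_derive_cosh_s u.
have dq := is_derive_scal _ _ (sqrt 2) _ (is_derive_div _ _ _ _ _ ch sh nz).
have dw := is_derive_minus _ _ _ _ _ dq (is_derive_const 2 u).
apply: (is_derive_ext _ _ _ _ _ (is_derive_eq _ _ _ (w u ^ 2 + 4 * w u + 2) dw _)) => [t|].
  by rewrite /w /Rdiv -Rmult_assoc.
rewrite /minus /plus /opp /scal /mult /zero /= /mult /=.
(* With 2 written as [sqrt 2 * sqrt 2], the goal becomes a rational identity in which [sqrt 2] is a
   free symbol. *)
have -> : w u * (w u * 1) + 4 * w u + 2 = (w u + 2) * (w u + 2) - sqrt 2 * sqrt 2.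
  by rewrite sqrt2_sq; ring.
by rewrite /w; field.
Qed.

Lemma is_derive_z_pow_w u e : sinh (s u) <> 0 ->
  is_derive (fun u => z u * w u ^ e) u
    (z u * (INR e.+1 * w u ^ e.+1 + (2 + 4 * INR e) * w u ^ e + 2 * INR e * w u ^ e.-1)).
Proof.
move=> nz.
have dp := is_derive_pow _ e _ _ (is_derive_w u nz).
apply: is_derive_eq (is_derive_mult _ _ _ _ _ (is_derive_z u nz) dp Rmult_comm) _.
rewrite /plus /mult /= -/(INR e.+1) S_INR; case: e {dp} => [|e] /=; ring.
Qed.

Definition dz (n : nat) (u : R) : R := z u * sum_f_R0 (fun e => coef n e * w u ^ e) n.

Lemma is_derive_dz n u : sinh (s u) <> 0 -> is_derive (dz n) u (dz n.+1 u).
Proof.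
move=> nz; rewrite {2}/dz -sum_coef_derive /dz.
pose d e := z u * (INR e.+1 * w u ^ e.+1 + (2 + 4 * INR e) * w u ^ e + 2 * INR e * w u ^ e.-1).
have term e : is_derive (fun u => coef n e * (z u * w u ^ e)) u (coef n e * d e).
  exact: is_derive_scal (is_derive_z_pow_w u e nz).
apply: (is_derive_ext (fun u => sum_n (fun e => coef n e * (z u * w u ^ e)) n)) => [t|].
  rewrite sum_n_Reals scal_sum; apply: sum_eq => e _; ring.
have := is_derive_sum_n _ n _ _ (fun e _ => term e) => /is_derive_eq; apply.
rewrite sum_n_Reals scal_sum; apply: sum_eq => e _; rewrite /d; ring.
Qed.

Lemma dz_bound n u : Rabs (w u) <= 1 -> Rabs (z u) <= 2 ->
  Rabs (dz n u) <= 2 * 7 ^ n * INR n`!.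
Proof.
move=> w1 z2; rewrite /dz Rabs_mult Rmult_assoc.
apply: Rmult_le_compat; try exact: Rabs_pos; first by [].
apply: Rle_trans (sum_coef_le n); apply: Rle_trans (Rsum_abs _ _) _.
apply: sum_Rle => e _; rewrite Rabs_mult (Rabs_pos_eq _ (coef_ge0 n e)) -RPow_abs.
rewrite -[X in _ <= X]Rmult_1_r; apply: Rmult_le_compat_l; first exact: coef_ge0.
by rewrite -(pow1 e); apply: pow_incr; split=> //; apply: Rabs_pos.
Qed.

(** * The closed form and its expansion at 0 *)

Definition egf (u : R) : R := 1 / sqrt 2 * (arcsinh (1 / sinh (s u)) - arcsinh 1).

(** Positivity of [sinh (s u)] fixes the sign in [sqrt (z^2 + 1) = cosh (s u) * z u]. This cancels
    the factor [w u + 2] of [z'] up to [sqrt 2], which the prefactor removes. *)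
Lemma is_derive_egf u : 0 < sinh (s u) -> is_derive egf u (z u).
Proof.
move=> pos; have nz : sinh (s u) <> 0 by lra.
have dc := is_derive_comp _ _ _ _ _ (is_derive_arcsinh (z u)) (is_derive_z u nz).
have dm := is_derive_minus _ _ _ _ _ dc (is_derive_const (arcsinh 1) u).
have := is_derive_scal _ _ (1 / sqrt 2) _ dm => d.
apply: (is_derive_ext _ _ _ _ _ (is_derive_eq _ _ _ (z u) d _)) => [t|].
  by rewrite /egf /z [1 / sinh _]Rdiv_1_l.
have -> : sqrt (z u ^ 2 + 1) = cosh (s u) * z u.
  rewrite -[RHS]sqrt_Rsqr; last first.
    apply: Rmult_le_pos; first exact/Rlt_le/cosh_gt0.
    by apply/Rlt_le/Rinv_0_lt_compat.
  congr sqrt; rewrite /Rsqr (_ : _ * _ = cosh (s u) * cosh (s u) * z u ^ 2); last by ring.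
  by rewrite cosh2 /z; field.
have ? := cosh_gt0 (s u); have q0 : 0 < sqrt 2 by apply: sqrt_lt_R0; lra.
have -> : w u + 2 = sqrt 2 * cosh (s u) * z u by rewrite /w /z; field.
rewrite /minus /plus /opp /scal /mult /zero /= /mult /= /z; field.
by split; [|split]; lra.
Qed.

Lemma sinh_s0 : sinh (s 0) = 1.
Proof. by rewrite /s Rmult_0_r Rminus_0_r sinh_arcsinh. Qed.

Lemma z0 : z 0 = 1.
Proof. by rewrite /z sinh_s0 Rinv_1. Qed.

Lemma w0 : w 0 = 0.
Proof.
rewrite /w sinh_s0 Rdiv_1_r; have := cosh2 (s 0); rewrite sinh_s0.
have ? := cosh_gt0 (s 0); have ? := sqrt2_sq; have ? : 0 < sqrt 2 by apply: sqrt_lt_R0; lra.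
move=> c2; have -> : cosh (s 0) = sqrt 2 by nra.
lra.
Qed.

Lemma egf0 : egf 0 = 0.
Proof. by rewrite /egf sinh_s0 Rdiv_1_r Rminus_diag Rmult_0_r. Qed.

Lemma dz0 n : dz n 0 = INR (U n.+1).
Proof.
rewrite /dz z0 w0 Rmult_1_l U_count_ge.
rewrite (sum_eq _ (fun e => if e is 0%nat then INR (count_ge n.+1 0) else 0)); last first.
  case=> [|e] _; last by rewrite pow_i ?Rmult_0_r //; lia.
  by rewrite /coef addn0 /= !Rmult_1_r Rdiv_1_r.
(* The induction is on the upper limit of the sum only; the count stays fixed. *)
by elim: {2}n => //= m ->; rewrite Rplus_0_r.
Qed.

Lemma locally_close (f : R -> R) x d : ex_derive f x -> 0 < d ->
  locally x (fun u => Rabs (f u - f x) < d).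
Proof.
move=> df d0; exact: (ex_derive_continuous f x df _ (locally_ball (f x) (mkposreal d d0))).
Qed.

Theorem theorem3p13 :
  exists r : R, 0 < r /\
    forall x : R, Rabs x < r ->
      is_pseries (fun n : nat => INR (U n) / INR n`!) x
        (1 / sqrt 2 *
          (arcsinh (1 / sinh (arcsinh 1 - sqrt 2 * x)) - arcsinh 1)).
Proof.
have nz0 : sinh (s 0) <> 0 by rewrite sinh_s0; lra.
(* Staying within 1 of the values 0, 1 and 1 at the origin ensures [|w| <= 1], [|z| <= 2] and
   [sinh (s u) > 0]. *)
have lw := locally_close w 0 1 (ex_intro _ _ (is_derive_w 0 nz0)) Rlt_0_1.
have lz := locally_close z 0 1 (ex_intro _ _ (is_derive_z 0 nz0)) Rlt_0_1.
have ls := locally_close _ 0 1 (ex_intro _ _ (is_derive_sinh_s 0)) Rlt_0_1.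
have [eps near0] := filter_and _ _ ls (filter_and _ _ lw lz).
(* The bound [1/8] ensures [7 r < 1], as the growth rate 7 of the coefficients requires. *)
pose r := Rmin eps (/ 8); have eps0 := cond_pos eps.
have [rle8 rleeps] : r <= / 8 /\ r <= eps by split; [apply: Rmin_r | apply: Rmin_l].
exists r; split; first by apply: Rmin_glb_lt => //; lra.
have near u : Rabs u < r -> [/\ 0 < sinh (s u), Rabs (w u) <= 1 & Rabs (z u) <= 2].
  move=> ur; have [|] := near0 u.
    by rewrite /ball /= /AbsRing_ball /abs /minus /plus /opp /= Ropp_0 Rplus_0_r; lra.
  rewrite sinh_s0 z0 w0 Rminus_0_r => hs [hw hz]; split; last 1 first.
  - by move: hz; rewrite /Rabs; repeat case: Rcase_abs => ?; lra.
  - by move: hs; rewrite /Rabs; case: Rcase_abs => ?; lra.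
  - by lra.
move=> x xr; rewrite -/(s x) -/(egf x).
(* Successive derivatives of [egf]: the first is [z], hence the index shift. *)
pose G n := if n is k.+1 then dz k else egf.
have G0 n : INR (U n) / INR n`! = G n 0 / INR n`!.
  case: n => [|n]; last by rewrite /= dz0.
  by have -> : G 0%nat 0 = INR (U 0) by exact: egf0.
apply: (is_series_ext _ _ _ _ (is_pseries_taylor G r 2 7 _ _ _ _ x xr)) => [n||||].
- by rewrite G0.
- by lra.
- by lra.
- move=> [|n] t /near[st _ _]; last by apply: is_derive_dz; lra.
  have -> : G 1%nat t = z t by rewrite /= /dz /= coef_zero !Rmult_1_r.
  exact: is_derive_egf.
- by move=> n t /near[_ wt zt]; apply: dz_bound.
Qed.
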